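(* Let $X\in G$ satisfy $X\in USS(X)$ and let $s$ be a minimal simple element for $X$ (with respect to $USS(X)$). Then exactly one of the following holds: (1) $\varphi(X)s$ is a simple element; (2) the pair $\varphi(X), s$ is left weighted, i.e. $\varphi(X)s$ is in left normal form as written.
   Context: $G$ is a Garside group: it has a lattice order $\preccurlyeq$ invariant under left multiplication ($a\preccurlyeq b$ iff $a^{-1}b\in P$, where $P=\{p\in G:1\preccurlyeq p\}$ is the monoid of positive elements), with meet $\wedge$; there is a Garside element $\Delta\in P$ such that $[1,\Delta]=\{s:1\preccurlyeq s\preccurlyeq\Delta\}$ is finite and generates $G$ and $\Delta^{-1}P\Delta=P$; and $P$ is atomic. Elements of $[1,\Delta]$ are called simple; $q$ is a prefix of $x$ if $q\preccurlyeq x$. $\tau(x)=\Delta^{-1}x\Delta$. For simple $u$, $\partial(u)=u^{-1}\Delta$. Notation: $X^a=a^{-1}Xa$. Every $X\in G$ has a unique left normal form $X=\Delta^p x_1\cdots x_r$ where $p$ is maximal with $\Delta^p\preccurlyeq X$ and each $x_i\neq 1$ is the maximal simple prefix of $x_i\cdots x_r$; $\inf X=p$, $\sup X=p+r$, $\ell(X)=r$. Simple $a,b$ form a left weighted pair if $ab$ is in left normal form as written (equivalently $\partial(a)\wedge b=1$). Define $\iota(X)=\tau^{-p}(x_1)$, $\varphi(X)=x_r$ if $r>0$, and $\iota(\Delta^p)=1$, $\varphi(\Delta^p)=\Delta$. Cycling: $\mathbf c(X)=X^{\iota(X)}$. $SSS(X)$ is the set of conjugates of $X$ having maximal infimum and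 minimal supremum in the conjugacy class; $USS(X)$ is the set of $Y\in SSS(X)$ with $\mathbf c^m(Y)=Y$ for some $m>0$. For $Y\in USS(X)$, a minimal simple element for $Y$ (with respect to $USS(X)$) is a simple $s\neq1$ with $Y^s\in USS(X)$ such that no prefix $t\neq 1$, $t\neq s$ of $s$ satisfies $Y^t\in USS(X)$. *)

(* Defs.v *)
From Stdlib Require Import ZArith List ClassicalEpsilon.
Import ListNotations.
Set Implicit Arguments.
Unset Strict Implicit.

(* A Garside group: a group G, with the submonoid P of positive elements
   inducing the prefix order  a <= b  iff  a^-1 b \in P  (left invariant by
   construction), which is a lattice (meet/join), a Garside element Delta,
   the set of simples [1,Delta] finite and generating G, Delta^-1 P Delta = P,
   and P atomic. *)
Record GarsideGroup := {
  gcar :> Type;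
  gmul : gcar -> gcar -> gcar;
  ginv : gcar -> gcar;
  gone : gcar;
  gmulA : forall a b c, gmul a (gmul b c) = gmul (gmul a b) c;
  gmul1l : forall a, gmul gone a = a;
  gmul1r : forall a, gmul a gone = a;
  gmulVl : forall a, gmul (ginv a) a = gone;
  gmulVr : forall a, gmul a (ginv a) = gone;
  gpos : gcar -> Prop;
  gpos1 : gpos gone;
  gposM : forall a b, gpos a -> gpos b -> gpos (gmul a b);
  gpos_antisym : forall a, gpos a -> gpos (ginv a) -> a = gone;
  gmeet : gcar -> gcar -> gcar;
  gjoin : gcar -> gcar -> gcar;
  gmeet_l : forall a b, gpos (gmul (ginv (gmeet a b)) a);
  gmeet_r : forall a b, gpos (gmul (ginv (gmeet a b)) b);
  gmeet_glb : forall a b c, gpos (gmul (ginv c) a) -> gpos (gmul (ginv c) b) ->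
                gpos (gmul (ginv c) (gmeet a b));
  gjoin_l : forall a b, gpos (gmul (ginv a) (gjoin a b));
  gjoin_r : forall a b, gpos (gmul (ginv b) (gjoin a b));
  gjoin_lub : forall a b c, gpos (gmul (ginv a) c) -> gpos (gmul (ginv b) c) ->
                gpos (gmul (ginv (gjoin a b)) c);
  gDelta : gcar;
  gDelta_pos : gpos gDelta;
  gsimples_finite : exists l : list gcar, forall s,
      gpos s -> gpos (gmul (ginv s) gDelta) -> In s l;
  gsimples_generate : forall g, exists l : list (bool * gcar),
      (forall e, In e l -> gpos (snd e) /\ gpos (gmul (ginv (snd e)) gDelta)) /\
      g = fold_right (fun (e : bool * gcar) (acc : gcar) => gmul (if fst e then snd e else ginv (snd e)) acc) gone l;
  gDelta_conj : forall p, gpos p <-> gpos (gmul (gmul (ginv gDelta) p) gDelta);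
  gatomic : forall p, gpos p -> exists N : nat, forall l : list gcar,
      (forall a : gcar, In a l -> gpos a /\ a <> gone) ->
      fold_right gmul gone l = p -> (length l <= N)%nat
}.

Section Garside.
Variable G : GarsideGroup.

Local Notation "a * b" := (gmul a b).
Local Notation "a ^-1" := (ginv a) (at level 3).
Local Notation "1" := (gone G).
Local Notation Delta := (gDelta G).

Definition prefix (a b : G) : Prop := gpos (a^-1 * b).
Definition simple (s : G) : Prop := prefix 1 s /\ prefix s Delta.

Definition gpow (x : G) (k : Z) : G :=
  match k with
  | Z0 => 1
  | Zpos n => Nat.iter (Pos.to_nat n) (fun y => x * y) 1
  | Zneg n => Nat.iter (Pos.to_nat n) (fun y => x^-1 * y) 1
  end.

Definition gprod (l : list G) : G := fold_right (@gmul G) 1 l.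

Definition taun (k : Z) (x : G) : G := gpow Delta (- k) * x * gpow Delta k.
Definition tau (x : G) : G := taun 1 x.

Definition gpartial (u : G) : G := u^-1 * Delta.

Definition conj (X a : G) : G := a^-1 * X * a.

Definition is_lnf (X : G) (p : Z) (xs : list G) : Prop :=
  gpow Delta p * gprod xs = X /\
  prefix (gpow Delta p) X /\
  (forall q, prefix (gpow Delta q) X -> (q <= p)%Z) /\
  (forall i, (i < length xs)%nat ->
     let x := nth i xs 1 in
     let rest := gprod (skipn i xs) in
     x <> 1 /\ simple x /\ prefix x rest /\
     (forall t, simple t -> prefix t rest -> prefix t x)).

Definition lnf (X : G) : Z * list G :=
  epsilon (inhabits (0%Z, @nil G)) (fun pr => is_lnf X (fst pr) (snd pr)).

Definition ginf (X : G) : Z := fst (lnf X).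
Definition glen (X : G) : nat := length (snd (lnf X)).
Definition gsup (X : G) : Z := (ginf X + Z.of_nat (glen X))%Z.

Definition giota (X : G) : G :=
  match snd (lnf X) with
  | [] => 1
  | x1 :: _ => taun (- ginf X) x1
  end.

Definition gvarphi (X : G) : G :=
  match snd (lnf X) with
  | [] => Delta
  | x :: xs => last (x :: xs) 1
  end.

Definition cycling (X : G) : G := conj X (giota X).

Definition left_weighted (a b : G) : Prop :=
  simple a /\ simple b /\ gmeet (gpartial a) b = 1.

Definition conjugate (Y X : G) : Prop := exists a, Y = conj X a.

Definition in_SSS (X Y : G) : Prop :=
  conjugate Y X /\
  forall Z, conjugate Z X -> (ginf Z <= ginf Y)%Z /\ (gsup Y <= gsup Z)%Z.

Definition in_USS (X Y : G) : Prop :=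
  in_SSS X Y /\ exists m : nat, (0 < m)%nat /\ Nat.iter m cycling Y = Y.

Definition minimal_simple (X Y s : G) : Prop :=
  simple s /\ s <> 1 /\ in_USS X (conj Y s) /\
  forall t, prefix 1 t -> prefix t s -> t <> 1 -> t <> s -> ~ in_USS X (conj Y t).

End Garside.

Definition xor (A B : Prop) : Prop := (A /\ ~ B) \/ (~ A /\ B).

(* Main.v *)
(** Fix [p = inf X] and [q = sup X]. Cycling is conjugation by the meet of [X * Delta^-p]
    with [Delta], and the complement of the last factor of [X] is the meet of
    [X^-1 * Delta^q] with [Delta]. Hence transport along cycling,
    [a |-> iota(X)^-1 * a * iota(X^a)], is up to a left factor the map sending [a] to the
    meet of [X * a * Delta^-p] with [a * Delta]; it preserves meets and simple elements
    and sends the complement of the last factor of [X] to that of the cycling of [X].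
    As there are finitely many simple elements and transport is injective, a simple element
    conjugating a cycling-periodic element to another one is itself periodic under transport.
    So ultra summit conjugates by simple elements are closed under meets, and conjugation by
    the complement of the last factor stays in the ultra summit set. The meet of [s] with that
    complement is thus [1] or [s] by minimality, and these are the two cases. *)

Require Import Defs.
From Stdlib Require Import ZArith List ClassicalEpsilon.
From Stdlib Require Import Lia Classical.
Import ListNotations.
Set Implicit Arguments.
Unset Strict Implicit.

Section GarsideTheory.
Variable G : GarsideGroup.
Implicit Types a b c s t u x y A B W X Y : G.

Local Notation "a * b" := (gmul a b).
Local Notation "a ^-1" := (ginv a) (at level 3).
Local Notation "1" := (gone G).
Local Notation Delta := (gDelta G).
Local Notation "'D^' k" := (gpow (gDelta G) k) (at level 3, k at level 3).
Local Notation "a <<= b" := (prefix a b) (at level 70).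
Local Notation "a ^^ b" := (gmeet a b) (at level 45, left associativity).

(** * Group identities *)

Lemma mulKl a b : a^-1 * (a * b) = b.
Proof. now rewrite gmulA, gmulVl, gmul1l. Qed.

Lemma mulKr a b : a * (a^-1 * b) = b.
Proof. now rewrite gmulA, gmulVr, gmul1l. Qed.

Lemma mul_inj a b c : a * b = a * c -> b = c.
Proof. intros E; rewrite <- (mulKl a b), E; apply mulKl. Qed.

Lemma invV a : a^-1^-1 = a.
Proof. now apply (@mul_inj a^-1); rewrite gmulVr, gmulVl. Qed.

Lemma invM a b : (a * b)^-1 = b^-1 * a^-1.
Proof.
  apply (@mul_inj (a * b)).
  now rewrite gmulVr, <- gmulA, mulKr, gmulVr.
Qed.

Lemma inv1 : 1^-1 = 1 :> G.
Proof. now rewrite <- (gmul1l 1^-1), gmulVr. Qed.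

Lemma mulA_r a b c : (a * b) * c = a * (b * c).
Proof. now rewrite gmulA. Qed.

Hint Rewrite mulA_r gmul1l gmul1r gmulVl gmulVr mulKl mulKr invV invM inv1 : grp.
Ltac grp := autorewrite with grp; try reflexivity.

Lemma mul_cancel_r a b c : b * a = c * a -> b = c.
Proof.
  intros E; rewrite <- (gmul1r b), <- (gmul1r c), <- (gmulVr a), !gmulA, E.
  reflexivity.
Qed.

(** * Integer powers *)

Lemma gpow_nat x n : gpow x (Z.of_nat n) = Nat.iter n (fun y => x * y) 1.
Proof. destruct n as [|n]; [easy|]. cbn -[Nat.iter]. now rewrite SuccNat2Pos.id_succ. Qed.

Lemma gpow_opp_nat x n :
  gpow x (- Z.of_nat n) = Nat.iter n (fun y => x^-1 * y) 1.
Proof. destruct n as [|n]; [easy|]. cbn -[Nat.iter]. now rewrite SuccNat2Pos.id_succ. Qed.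

Lemma gpow_succ x k : gpow x (Z.succ k) = x * gpow x k.
Proof.
  destruct (Z_le_gt_dec 0 k) as [H|H].
  - rewrite <- (Z2Nat.id k H), <- Nat2Z.inj_succ, !gpow_nat; reflexivity.
  - replace k with (- Z.of_nat (S (Z.to_nat (- k - 1%Z))))%Z at 2 by lia.
    replace (Z.succ k) with (- Z.of_nat (Z.to_nat (- k - 1%Z)))%Z by lia.
    rewrite !gpow_opp_nat; simpl. now rewrite mulKr.
Qed.

Lemma gpow1 x : gpow x 1 = x.
Proof. cbn. apply gmul1r. Qed.

Lemma gpow_add x j k : gpow x (j + k) = gpow x j * gpow x k.
Proof.
  induction j as [|j IH|j IH] using Z.peano_ind.
  - simpl. now grp.
  - now rewrite Z.add_succ_l, !gpow_succ, IH, gmulA.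
  - apply (@mul_inj x).
    now rewrite <- gpow_succ, gmulA, <- gpow_succ, <- Z.add_succ_l,
      Z.succ_pred.
Qed.

Lemma gpow_opp x k : gpow x (- k) = (gpow x k)^-1.
Proof.
  apply (@mul_inj (gpow x k)).
  now rewrite <- gpow_add, gmulVr, Z.add_opp_diag_r.
Qed.

(** * Prefix order, meets and powers of [Delta] *)

Lemma pre_refl a : a <<= a.
Proof. unfold prefix; grp. apply gpos1. Qed.

Lemma pre_trans b a c : a <<= b -> b <<= c -> a <<= c.
Proof.
  unfold prefix; intros Hab Hbc.
  replace (a^-1 * c) with ((a^-1 * b) * (b^-1 * c)) by grp.
  now apply gposM.
Qed.

Lemma pre_mul2l c a b : c * a <<= c * b <-> a <<= b.
Proof. unfold prefix; grp; easy. Qed.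

Lemma pre_antisym a b : a <<= b -> b <<= a -> a = b.
Proof.
  unfold prefix; intros Hab Hba; apply (@mul_inj a^-1).
  rewrite gmulVl; symmetry; apply gpos_antisym; [easy|].
  now grp.
Qed.

Lemma gpos_pre a : gpos a <-> 1 <<= a.
Proof. unfold prefix; grp; easy. Qed.

Lemma pos_Delta : 1 <<= Delta.
Proof. exact (proj1 (gpos_pre _) (gDelta_pos G)). Qed.

Lemma pre_mulr a b : a <<= a * b <-> 1 <<= b.
Proof. rewrite <- (gmul1r a) at 1. apply pre_mul2l. Qed.

(** Conjugation by [Delta] preserves positivity, so this particular right multiplication respects
    the left-invariant order. *)
Lemma pre_mul2D a b : a * Delta <<= b * Delta <-> a <<= b.
Proof.
  unfold prefix; rewrite (gDelta_conj (a^-1 * b)); grp; easy.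
Qed.

Lemma pre_mul2r k a b : a * D^ k <<= b * D^ k <-> a <<= b.
Proof.
  assert (S : forall j, a * D^ (Z.succ j) <<= b * D^ (Z.succ j)
                        <-> a * D^ j <<= b * D^ j).
  { intros j; unfold Z.succ; now rewrite gpow_add, gpow1, !gmulA, pre_mul2D. }
  induction k as [|k IH|k IH] using Z.peano_ind.
  - simpl; grp; easy.
  - now rewrite S.
  - now rewrite <- S, Z.succ_pred.
Qed.

Lemma pre_shift k a b : a * D^ k <<= b <-> a <<= b * D^ (- k).
Proof.
  rewrite <- (pre_mul2r k a), mulA_r, <- gpow_add, Z.add_opp_diag_l; simpl.
  now rewrite gmul1r.
Qed.

Lemma pre_meet c a b : c <<= a ^^ b <-> c <<= a /\ c <<= b.
Proof.
  split.
  - intros H; split; eapply pre_trans; try exact H;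
      [apply gmeet_l | apply gmeet_r].
  - intros [Ha Hb]; now apply gmeet_glb.
Qed.

Lemma meet_prel a b : a ^^ b <<= a. Proof. apply gmeet_l. Qed.
Lemma meet_prer a b : a ^^ b <<= b. Proof. apply gmeet_r. Qed.

Lemma eq_of_pre a b : (forall c, c <<= a <-> c <<= b) -> a = b.
Proof. intros H; apply pre_antisym; apply H, pre_refl. Qed.

Lemma meetC a b : a ^^ b = b ^^ a.
Proof. apply eq_of_pre; intros c; rewrite !pre_meet; tauto. Qed.

Lemma meetACA a b c d : (a ^^ b) ^^ (c ^^ d) = (a ^^ c) ^^ (b ^^ d).
Proof. apply eq_of_pre; intros e; rewrite !pre_meet; tauto. Qed.

Lemma meet_l a b : a <<= b -> a ^^ b = a.
Proof.
  intros H; apply pre_antisym; [apply meet_prel|].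
  apply pre_meet; split; [apply pre_refl|easy].
Qed.

Lemma mul_meet c a b : c * (a ^^ b) = c * a ^^ c * b.
Proof.
  apply eq_of_pre; intros e.
  rewrite pre_meet, <- (mulKr c e), !pre_mul2l; apply pre_meet.
Qed.

Lemma meet_mulD a b k : (a ^^ b) * D^ k = a * D^ k ^^ b * D^ k.
Proof.
  apply eq_of_pre; intros e.
  rewrite <- (Z.opp_involutive k), pre_meet, <- !pre_shift.
  apply pre_meet.
Qed.

Lemma meet_mulDelta a b : (a ^^ b) * Delta = a * Delta ^^ b * Delta.
Proof. generalize (meet_mulD a b 1); now rewrite !gpow1. Qed.

Lemma gpow_comm x k : gpow x k * x = x * gpow x k.
Proof. rewrite <- gpow_succ; unfold Z.succ; now rewrite gpow_add, gpow1. Qed.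

Lemma pre_pow j k : (j <= k)%Z -> D^ j <<= D^ k.
Proof.
  intros H; replace k with (j + Z.of_nat (Z.to_nat (k - j)))%Z by lia.
  rewrite gpow_add, pre_mulr, gpow_nat.
  induction (Z.to_nat (k - j)) as [|n IH]; [apply pre_refl|].
  simpl; apply pre_trans with Delta.
  - apply pos_Delta.
  - now apply pre_mulr.
Qed.

Lemma pre_pow_le j k : Delta <> 1 -> D^ j <<= D^ k -> (j <= k)%Z.
Proof.
  intros D1 H; destruct (Z_le_gt_dec j k) as [|jk]; [easy|].
  case D1; apply pre_antisym; [|apply pos_Delta].
  rewrite <- (gpow1 Delta), <- (pre_mul2l D^ k), <- gpow_add, gmul1r.
  apply pre_trans with D^ j; [apply pre_pow; lia|easy].
Qed.

Lemma pos_pow k : (0 <= k)%Z -> 1 <<= D^ k.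
Proof. apply (@pre_pow 0). Qed.

(** * Left normal forms *)

(** Recursive form of the condition on factors in [is_lnf]: the maximal simple prefix of a positive
    element is its meet with [Delta]. *)
Fixpoint greedy (l : list G) : Prop :=
  match l with
  | [] => True
  | x :: r => x <> 1 /\ 1 <<= x /\ x = x * gprod r ^^ Delta /\ greedy r
  end.

Lemma gprod_app (l1 l2 : list G) : gprod (l1 ++ l2) = gprod l1 * gprod l2.
Proof. induction l1 as [|x l1 IH]; simpl; [now grp|rewrite IH; grp]. Qed.

Lemma greedy_appr l1 l2 : greedy (l1 ++ l2) -> greedy l2.
Proof. induction l1 as [|x l1 IH]; [easy|]; simpl; tauto. Qed.

Lemma greedy_pos l : greedy l -> 1 <<= gprod l.
Proof.
  induction l as [|x r IH]; [intros; apply pre_refl|].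
  intros [_ [Px [_ Gr]]]; simpl.
  apply pre_trans with x; [easy|now apply pre_mulr, IH].
Qed.

Lemma greedyP l :
  greedy l <->
  forall i, (i < length l)%nat ->
     let x := nth i l 1 in
     let rest := gprod (skipn i l) in
     x <> 1 /\ simple x /\ x <<= rest /\
     (forall t, simple t -> t <<= rest -> t <<= x).
Proof.
  induction l as [|x r IH]; [simpl; split; [lia|easy]|].
  split.
  - intros [x1 [Px [Ex Gr]]] [|i] Hi; simpl in Hi.
    + simpl; split; [easy|]; split; [|split].
      * split; [easy|rewrite Ex; apply meet_prer].
      * rewrite Ex at 1; apply meet_prel.
      * intros t [_ tD] tr; rewrite Ex, pre_meet; now split.
    + apply IH; [easy|lia].
  - intros H.
    destruct (H 0%nat) as [x1 [[Px xD] [xr Mx]]]; [simpl; lia|]; simpl in *.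
    repeat (split; [easy|]); split.
    + apply pre_antisym; [now apply pre_meet; split|].
      apply Mx; [split|apply meet_prel]; [|apply meet_prer].
      apply pre_meet; split; [now apply pre_trans with x|apply pos_Delta].
    + apply IH; intros i Hi; apply (H (S i)); simpl; lia.
Qed.

(** The left side is a prefix of both [A * D^ k] and [Delta * D^ k], hence of [x * D^ k]. This peels
    off one normal form factor. *)
Lemma meet_pow_step A x k : 1 <<= A -> x = A ^^ Delta -> (0 <= k)%Z ->
  A ^^ D^ (Z.succ k) = x * (x^-1 * A ^^ D^ k).
Proof.
  intros PA Ex k0; rewrite mul_meet, mulKr; apply pre_antisym;
    apply pre_meet; split; try apply meet_prel.
  - replace k with (- - k)%Z by lia; rewrite <- pre_shift, Ex, pre_meet.
    rewrite !pre_shift, !Z.opp_involutive; split.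
    + apply pre_trans with A; [apply meet_prel|].
      now apply pre_mulr, pos_pow.
    + rewrite <- gpow_succ; apply meet_prer.
  - apply pre_trans with (x * D^ k); [apply meet_prer|].
    rewrite gpow_succ, pre_mul2r, Ex; apply meet_prer.
Qed.

Lemma greedy_meet_pow l1 l2 : greedy (l1 ++ l2) ->
  gprod l1 = gprod (l1 ++ l2) ^^ D^ (Z.of_nat (length l1)).
Proof.
  induction l1 as [|x l1 IH]; intros Gl.
  - simpl; rewrite meetC, meet_l; [easy|]; exact (greedy_pos Gl).
  - assert (PA := greedy_pos Gl); destruct Gl as [x1 [_ [Ex Gr]]].
    change (length (x :: l1)) with (S (length l1)).
    rewrite Nat2Z.inj_succ, (meet_pow_step PA Ex); [|lia].
    simpl; now rewrite mulKl, <- (IH Gr).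
Qed.

(** Splitting off [A ^^ Delta] leaves a remainder below the next lower power of [Delta], so [n]
    steps suffice; a trivial factor is dropped. *)
Lemma exists_greedy n A : 1 <<= A -> A <<= D^ (Z.of_nat n) ->
  exists l, greedy l /\ gprod l = A.
Proof.
  revert A; induction n as [|n IH]; intros A PA HA.
  - exists []; split; [easy|]; now apply pre_antisym.
  - rewrite Nat2Z.inj_succ in HA.
    assert (E := meet_pow_step PA eq_refl (Zle_0_nat n)).
    rewrite (meet_l HA) in E; set (x := A ^^ Delta) in *.
    assert (Ex : A = x * (x^-1 * A)) by now rewrite mulKr.
    rewrite Ex in E at 1; apply mul_inj in E.
    destruct (IH (x^-1 * A)) as [l [Gl El]].
    + rewrite <- (pre_mul2l x), mulKr, gmul1r; apply meet_prel.
    + rewrite E; apply meet_prer.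
    + destruct (classic (x = 1)) as [x1|x1].
      * exists l; split; [easy|]; now rewrite El, x1, inv1, gmul1l.
      * exists (x :: l); simpl; rewrite El, mulKr; repeat split; try easy.
        apply pre_meet; split; [easy|apply pos_Delta].
Qed.

Lemma pre_invD a k : a^-1 <<= D^ k <-> D^ (- k) <<= a.
Proof.
  rewrite <- (pre_mul2l a), gmulVr, <- (gmul1l D^ (- k)), pre_shift.
  now rewrite Z.opp_involutive.
Qed.

(** Simple elements and their inverses lie between [D^ (- 1)] and [D^ 1], and they generate; each
    generator widens the bounds by one. *)
Lemma bounded X : exists n, D^ (- n) <<= X /\ X <<= D^ n.
Proof.
  destruct (gsimples_generate X) as [l [Sl ->]].
  induction l as [|[e u] l IH].
  - exists 0%Z; split; apply pre_refl.
  - destruct IH as [n [nX Xn]]; [intros e' He'; apply Sl; now right|].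
    destruct (Sl (e, u)) as [Pu uD]; [now left|]; simpl in Pu, uD |- *.
    set (W := fold_right _ _ _) in *.
    assert (B : forall v, D^ (- 1) <<= v -> v <<= D^ 1 ->
       exists n, D^ (- n) <<= v * W /\ v * W <<= D^ n).
    { intros v Dv vD; exists (1 + n)%Z; split.
      - replace (- (1 + n))%Z with (- 1 + - n)%Z by lia.
        rewrite gpow_add; apply pre_trans with (v * D^ (- n)).
        + now apply pre_mul2r.
        + now apply pre_mul2l.
      - rewrite gpow_add; apply pre_trans with (v * D^ n).
        + now apply pre_mul2l.
        + now apply pre_mul2r. }
    assert (Du : D^ (- 1) <<= u).
    { apply pre_trans with 1; [now apply (@pre_pow (-1) 0)|].
      exact (proj1 (gpos_pre _) Pu). }
    assert (uD1 : u <<= D^ 1) by now rewrite gpow1.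
    destruct e; apply B; [easy|easy| |].
    + apply (pre_invD u^-1 1); now rewrite invV.
    + now apply (pre_invD u 1).
Qed.

Section Nontrivial.
(** If [Delta] were [1], all its powers would agree, no exponent would be maximal, and [lnf] would
    be an arbitrary choice. *)
Hypothesis Delta_neq1 : Delta <> 1.

Lemma exists_lnf X : exists pr, is_lnf X (fst pr) (snd pr).
Proof.
  destruct (bounded X) as [n [nX Xn]].
  assert (Hp : exists p, D^ p <<= X /\ forall q, D^ q <<= X -> (q <= p)%Z).
  { assert (B : forall q, D^ q <<= X -> (q <= n)%Z).
    { intros q H; apply (pre_pow_le Delta_neq1); now apply pre_trans with X. }
    (* Climb from a known lower bound; [m] bounds the distance left to the upper bound [n]. *)
    assert (H : forall m k, (n - Z.of_nat m <= k)%Z -> D^ k <<= X ->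
       exists p, D^ p <<= X /\ forall q, D^ q <<= X -> (q <= p)%Z).
    { induction m as [|m IH]; intros k Hk kX.
      - exists k; split; [easy|]; intros q qX; specialize (B q qX); lia.
      - destruct (classic (D^ (Z.succ k) <<= X)) as [H|H].
        + apply (IH (Z.succ k)); [lia|easy].
        + exists k; split; [easy|]; intros q qX.
          destruct (Z_le_gt_dec q k) as [|qk]; [easy|]; case H.
          apply pre_trans with D^ q; [apply pre_pow; lia|easy]. }
    apply (H (Z.to_nat (n + n)) (- n)%Z); [lia|easy]. }
  destruct Hp as [p [pX Mp]].
  destruct (@exists_greedy (Z.to_nat (n - p)) (D^ (- p) * X)) as [l [Gl El]].
  - now rewrite <- (pre_mul2l D^ p), gpow_opp, mulKr, gmul1r.
  - rewrite <- (pre_mul2l D^ p), <- gpow_add, gpow_opp, mulKr.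
    apply pre_trans with D^ n; [easy|apply pre_pow; lia].
  - exists (p, l); simpl; unfold is_lnf.
    rewrite El, gpow_opp, mulKr; repeat (split; [easy|]).
    now apply greedyP.
Qed.

Lemma lnfP X : is_lnf X (ginf X) (snd (lnf X)).
Proof.
  unfold ginf, lnf; apply epsilon_spec.
  exact (exists_lnf X).
Qed.

Lemma lnf_greedy X : greedy (snd (lnf X)).
Proof. apply greedyP, lnfP. Qed.

Lemma lnf_prod X : D^ (ginf X) * gprod (snd (lnf X)) = X.
Proof. apply lnfP. Qed.

Lemma pre_ginf X k : D^ k <<= X <-> (k <= ginf X)%Z.
Proof.
  destruct (lnfP X) as [_ [pX [Mp _]]]; split; [apply Mp|intros H].
  apply pre_trans with D^ (ginf X); [now apply pre_pow|easy].
Qed.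

Lemma greedy_pre_pow l : greedy l -> gprod l <<= D^ (Z.of_nat (length l)).
Proof.
  intros Gl; rewrite <- (app_nil_r l) in Gl.
  rewrite (greedy_meet_pow Gl); apply meet_prer.
Qed.

(** Otherwise the first [n] factors already give the whole product, so the tail has product [1] and
    its first factor is trivial. *)
Lemma greedy_length l n :
  greedy l -> gprod l <<= D^ (Z.of_nat n) -> (length l <= n)%nat.
Proof.
  intros Gl H; destruct (Nat.le_gt_cases (length l) n) as [|nl]; [easy|].
  rewrite <- (firstn_skipn n l) in Gl.
  assert (E := greedy_meet_pow Gl).
  rewrite firstn_length_le, firstn_skipn, (meet_l H) in E by lia.
  assert (L := length_skipn n l).
  destruct (skipn n l) as [|x r] eqn:El; [simpl in L; lia|].
  assert (x1 : gprod (x :: r) = 1).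
  { apply (@mul_inj (gprod (firstn n l))).
    now rewrite <- gprod_app, <- El, firstn_skipn, gmul1r. }
  destruct (greedy_appr Gl) as [nx [_ [Ex _]]]; case nx.
  change (x * gprod r) with (gprod (x :: r)) in Ex.
  rewrite Ex, x1; apply meet_l, pos_Delta.
Qed.

Lemma gsup_pre X k : X <<= D^ k <-> (gsup X <= k)%Z.
Proof.
  unfold gsup, glen; set (l := snd (lnf X)).
  assert (Gl := lnf_greedy X : greedy l).
  assert (El := lnf_prod X : _ * gprod l = X).
  assert (S : X <<= D^ k <-> gprod l <<= D^ (k - ginf X)).
  { rewrite <- (pre_mul2l D^ (ginf X) (gprod l)), El, <- gpow_add.
    now replace (ginf X + (k - ginf X))%Z with k by lia. }
  rewrite S; split; intros H.
  - assert (ik : (0 <= k - ginf X)%Z).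
    { apply (pre_pow_le Delta_neq1), pre_trans with (gprod l); [|easy].
      now apply greedy_pos. }
    rewrite <- (Z2Nat.id _ ik) in H; apply (greedy_length Gl) in H; lia.
  - apply pre_trans with D^ (Z.of_nat (length l)); [now apply greedy_pre_pow|].
    apply pre_pow; lia.
Qed.

End Nontrivial.

(* This is [iota] when [k = ginf X]; with [k] fixed, the results on transport below hold
   for all [X], without any summit condition. *)
Definition iot k X : G := X * D^ (- k) ^^ Delta.

(** Conjugation by powers of [Delta] commutes with meets and fixes [Delta], so it carries the meet
    defining the first factor to [iot]. *)
Lemma giotaE X : Delta <> 1 -> giota X = iot (ginf X) X.
Proof.
  intros D1; unfold giota, iot.
  assert (Gl := lnf_greedy D1 X); assert (El := lnf_prod D1 X).
  destruct (snd (lnf X)) as [|x l].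
  - simpl in El; rewrite <- El at 1; rewrite gmul1r, <- gpow_add.
    rewrite Z.add_opp_diag_r, meet_l; [easy|apply pos_Delta].
  - destruct Gl as [_ [_ [Ex _]]]; unfold taun; rewrite Z.opp_involutive.
    rewrite Ex, mul_meet, meet_mulD.
    change (x * gprod l) with (gprod (x :: l)); rewrite El.
    f_equal; rewrite <- (gpow1 Delta) at 2; rewrite <- !gpow_add.
    replace (ginf X + 1 + - ginf X)%Z with 1%Z by lia; apply gpow1.
Qed.

(** By [greedy_meet_pow], the factors before the last one form a meet with a power of [Delta];
    multiplying by [Delta] and cancelling [X] gives [iot]. For a power of [Delta] both sides are
    [1]. *)
Lemma gpartial_gvarphi X : Delta <> 1 ->
  simple (gvarphi X) /\ gpartial (gvarphi X) = iot (- gsup X) X^-1.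
Proof.
  intros D1; unfold gpartial, gvarphi, gsup, glen, iot; rewrite Z.opp_involutive.
  assert (Gl := lnf_greedy D1 X); assert (El := lnf_prod D1 X).
  destruct (snd (lnf X)) as [|x l] eqn:E.
  - simpl in El |- *; rewrite gmul1r in El; rewrite Z.add_0_r, El.
    rewrite !gmulVl, meet_l by apply pos_Delta; split; [|easy].
    split; [apply pos_Delta|apply pre_refl].
  - assert (nl : x :: l <> []) by easy.
    set (l' := x :: l) in *; clearbody l'; clear E x l.
    destruct (exists_last nl) as [m [z ->]].
    rewrite last_last, length_app, Nat.add_1_r, Nat2Z.inj_succ; simpl.
    destruct (greedy_appr Gl) as [_ [Pz [Ez _]]].
    split; [split; [easy|rewrite Ez; apply meet_prer]|].
    apply (@mul_inj X); rewrite mul_meet, mulKr.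
    assert (EX : X = D^ (ginf X) * gprod m * z).
    { now rewrite <- El at 1; rewrite gprod_app; simpl; grp. }
    rewrite EX at 1; rewrite !mulA_r, mulKr, (greedy_meet_pow Gl), meetC.
    rewrite <- (gpow1 Delta) at 3; rewrite meet_mulD, mul_meet.
    rewrite <- !gpow_add, gmulA, El, gpow1; f_equal; f_equal; lia.
Qed.

(** * Transport along cycling *)

Definition cyc k X : G := conj X (iot k X).
Definition transport k X a : G := (iot k X)^-1 * (a * iot k (conj X a)).

Lemma conjM X a b : conj X (a * b) = conj (conj X a) b.
Proof. unfold conj; grp. Qed.

Lemma conj1 X : conj X 1 = X.
Proof. unfold conj; grp. Qed.

(** Clears the inverse of [a]: here [a] is only multiplied on the left by [X] and on the right by
    powers of [Delta], operations that preserve meets. *)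
Lemma mul_iot_conj k X a :
  a * iot k (conj X a) = X * (a * D^ (- k)) ^^ a * Delta.
Proof. unfold iot, conj; rewrite mul_meet; grp. Qed.

Lemma cyc_conj k X a : cyc k (conj X a) = conj (cyc k X) (transport k X a).
Proof. unfold cyc, transport; now rewrite <- !conjM, mulKr. Qed.

Lemma transport_meet k X a b :
  transport k X (a ^^ b) = transport k X a ^^ transport k X b.
Proof.
  unfold transport; rewrite <- mul_meet, !mul_iot_conj; f_equal.
  rewrite meetACA, meet_mulD, mul_meet; f_equal.
  apply meet_mulDelta.
Qed.

Lemma transport1 k X : transport k X 1 = 1.
Proof. unfold transport; rewrite conj1; grp. Qed.

Lemma transportDelta k X : transport k X Delta = Delta.
Proof.
  unfold transport; rewrite mul_iot_conj; apply (@mul_inj (iot k X)).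
  rewrite mulKr; unfold iot.
  now rewrite meet_mulDelta, mulA_r, gpow_comm.
Qed.

(** In this form simplicity passes through transport, which preserves meets and fixes [1] and
    [Delta]. *)
Lemma simple_meet s : simple s <-> 1 ^^ s = 1 /\ s ^^ Delta = s.
Proof.
  split; intros [H1 H2].
  - split; apply meet_l; assumption.
  - split; [rewrite <- H1|rewrite <- H2]; apply meet_prer.
Qed.

Lemma transport_simple k X s : simple s -> simple (transport k X s).
Proof.
  rewrite !simple_meet; intros [H1 H2]; split.
  - now rewrite <- (transport1 k X) at 1; rewrite <- transport_meet, H1, transport1.
  - now rewrite <- (transportDelta k X) at 1; rewrite <- transport_meet, H2.
Qed.

(** Equal conjugates have the same [iot], so the outer factors of the two transports agree and
    cancel. *)
Lemma transport_inj k X a b : conj X a = conj X b ->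
  transport k X a = transport k X b -> a = b.
Proof.
  unfold transport; intros E; rewrite E; intros H.
  apply mul_inj in H; now apply mul_cancel_r in H.
Qed.

(* At [- sup X] this says that twisted decycling commutes with cycling,
   by [gpartial_gvarphi]. *)
Lemma transport_iotV k q X :
  transport k X (iot q X^-1) = iot q (cyc k X)^-1.
Proof.
  apply (@mul_inj (iot k X)); unfold transport; rewrite mulKr, mul_iot_conj.
  assert (E : (cyc k X)^-1 = conj X^-1 (iot k X)) by (unfold cyc, conj; grp).
  rewrite E, mul_iot_conj; unfold iot.
  (* Both sides expand to meets of the same four elements, grouped differently: [D^ (- k - q)],
     [X * D^ (1 - k)], [X^-1 * D^ (1 - q)] and [D^ 2]. *)
  rewrite !meet_mulDelta, !meet_mulD, !mul_meet, !mulA_r, !mulKl, !mulKr.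
  rewrite !gpow_comm, meetACA, <- !gpow_add; do 3 f_equal; lia.
Qed.

(** Transport depends on the base element, so iterating it must carry that element along. *)
Definition transport_pair k (p : G * G) : G * G :=
  (cyc k (fst p), transport k (fst p) (snd p)).

Lemma fst_iter_transport k n X a :
  fst (Nat.iter n (transport_pair k) (X, a)) = Nat.iter n (cyc k) X.
Proof. induction n as [|n IH]; simpl; [easy|now rewrite IH]. Qed.

Lemma iter_cyc_conj k n X a :
  Nat.iter n (cyc k) (conj X a) =
  conj (Nat.iter n (cyc k) X) (snd (Nat.iter n (transport_pair k) (X, a))).
Proof.
  induction n as [|n IH]; simpl; [easy|].
  now rewrite IH, cyc_conj, fst_iter_transport.
Qed.

Lemma iter_transport_simple k n X s : simple s ->
  simple (snd (Nat.iter n (transport_pair k) (X, s))).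
Proof.
  intros Ss; induction n as [|n IH]; simpl; [easy|now apply transport_simple].
Qed.

Lemma iter_transport_meet k n X a b :
  snd (Nat.iter n (transport_pair k) (X, a ^^ b)) =
  snd (Nat.iter n (transport_pair k) (X, a)) ^^
  snd (Nat.iter n (transport_pair k) (X, b)).
Proof.
  induction n as [|n IH]; simpl; [easy|].
  now rewrite IH, transport_meet, !fst_iter_transport.
Qed.

Lemma iter_transport_iotV k q n X :
  snd (Nat.iter n (transport_pair k) (X, iot q X^-1)) =
  iot q (Nat.iter n (cyc k) X)^-1.
Proof.
  induction n as [|n IH]; simpl; [easy|].
  now rewrite IH, fst_iter_transport, transport_iotV.
Qed.

Lemma iter_transport_inj k n X a b : conj X a = conj X b ->
  Nat.iter n (transport_pair k) (X, a) = Nat.iter n (transport_pair k) (X, b) ->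
  a = b.
Proof.
  intros E; induction n as [|n IH]; simpl; [congruence|].
  intros H; injection H as _ H; apply IH.
  rewrite !fst_iter_transport in H; apply transport_inj in H.
  - apply injective_projections; [now rewrite !fst_iter_transport|easy].
  - now rewrite <- !iter_cyc_conj, E.
Qed.

(** * Periodicity under cycling and transport *)

Definition periodic (T : Type) (f : T -> T) (x : T) : Prop :=
  exists n, (0 < n)%nat /\ Nat.iter n f x = x.

Lemma iter_mul_fix (T : Type) (f : T -> T) (x : T) m n :
  Nat.iter n f x = x -> Nat.iter (m * n) f x = x.
Proof.
  intros E; induction m as [|m IH]; simpl; [easy|].
  now rewrite Nat.iter_add, IH.
Qed.

Lemma periodic_common (T U : Type) (f : T -> T) (g : U -> U) (x : T) (y : U) :
  periodic f x -> periodic g y ->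
  exists n, (0 < n)%nat /\ Nat.iter n f x = x /\ Nat.iter n g y = y.
Proof.
  intros [m [m0 Em]] [n [n0 En]]; exists (m * n)%nat; split; [lia|].
  split; [rewrite Nat.mul_comm|]; now apply iter_mul_fix.
Qed.

Lemma pigeonhole (T : Type) (u : nat -> T) (l : list T) :
  (forall i, In (u i) l) -> exists i j, (i < j)%nat /\ u i = u j.
Proof.
  intros H; apply NNPP; intros N.
  assert (ND : NoDup (map u (seq 0 (S (length l))))).
  { apply NoDup_map_NoDup_ForallPairs; [|apply seq_NoDup].
    intros i j _ _ E; destruct (Nat.lt_trichotomy i j) as [L|[L|L]]; [|easy|];
      case N; [exists i, j|exists j, i]; now split. }
  apply (NoDup_incl_length (l' := l)) in ND.
  - rewrite length_map, length_seq in ND; lia.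
  - intros x Hx; apply in_map_iff in Hx; destruct Hx as [i [<- _]]; apply H.
Qed.

(** Transports of [s] over multiples of a common period remain simple, so two coincide; injectivity
    cancels the steps before the repetition. *)
Lemma periodic_transport k X s : simple s ->
  periodic (cyc k) X -> periodic (cyc k) (conj X s) ->
  periodic (transport_pair k) (X, s).
Proof.
  intros Ss PX PXs; destruct (periodic_common PX PXs) as [m [m0 [EX EXs]]].
  destruct (gsimples_finite G) as [l Hl].
  pose (u i := snd (Nat.iter (i * m) (transport_pair k) (X, s))).
  assert (Eu : forall i, Nat.iter (i * m) (transport_pair k) (X, s) = (X, u i)).
  { intros i; apply injective_projections; [|easy].
    rewrite fst_iter_transport; now apply iter_mul_fix. }
  (* As [conj X s] returns too, all [u i] conjugate [X] to the same element, as injectivity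
     requires. *)
  assert (Cu : forall i, conj X (u i) = conj X s).
  { intros i; generalize (iter_cyc_conj k (i * m) X s).
    rewrite Eu; simpl; rewrite !iter_mul_fix by easy; easy. }
  destruct (@pigeonhole _ u l) as [i [j [ij E]]].
  { intros i; destruct (iter_transport_simple k (i * m) X Ss) as [H1 H2].
    now apply Hl; [apply gpos_pre|]. }
  exists ((j - i) * m)%nat; split; [nia|].
  rewrite Eu; f_equal; symmetry; apply (@iter_transport_inj k (i * m) X).
  - now rewrite Cu.
  - rewrite <- (Eu (j - i)%nat), <- Nat.iter_add, <- Nat.mul_add_distr_r.
    replace (i + (j - i))%nat with j by lia; now rewrite !Eu, E.
Qed.

(** After a common period, transport returns both [s] and [t], hence also their meet. *)
Lemma periodic_cyc_meet k X s t : simple s -> simple t ->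
  periodic (cyc k) X -> periodic (cyc k) (conj X s) ->
  periodic (cyc k) (conj X t) -> periodic (cyc k) (conj X (s ^^ t)).
Proof.
  intros Ss St PX Ps Pt.
  destruct (periodic_common (periodic_transport Ss PX Ps)
              (periodic_transport St PX Pt)) as [n [n0 [Es Et]]].
  exists n; split; [easy|].
  rewrite iter_cyc_conj, iter_transport_meet, Es, Et; simpl.
  now rewrite <- (fst_iter_transport k n X s), Es.
Qed.

Lemma periodic_cyc_iotV k q X :
  periodic (cyc k) X -> periodic (cyc k) (conj X (iot q X^-1)).
Proof.
  intros [n [n0 E]]; exists n; split; [easy|].
  now rewrite iter_cyc_conj, iter_transport_iotV, E.
Qed.

(** * Super summit and ultra summit sets *)

Lemma pre_conj_pow X a k : D^ k <<= conj X a <-> a * D^ k <<= X * a.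
Proof. now rewrite <- (pre_mul2l a); unfold conj; rewrite mulA_r, mulKr. Qed.

Lemma pre_pow_conj X a k : conj X a <<= D^ k <-> X * a <<= a * D^ k.
Proof. now rewrite <- (pre_mul2l a); unfold conj; rewrite mulA_r, mulKr. Qed.

(** Here [iot k X] is positive, so [iot k X * D^ k <<= X <<= X * iot k X]. *)
Lemma pre_cyc k X : D^ k <<= X -> D^ k <<= cyc k X.
Proof.
  intros H; apply pre_conj_pow; unfold iot; apply pre_trans with X.
  - rewrite pre_shift; apply meet_prel.
  - apply pre_mulr, pre_meet; split; [|apply pos_Delta].
    now rewrite <- (gmul1l D^ k), pre_shift in H.
Qed.

Lemma conjugate_refl X : conjugate X X.
Proof. exists 1; now rewrite conj1. Qed.

Lemma conjugate_conj X Y a : conjugate Y X -> conjugate (conj Y a) X.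
Proof. intros [b ->]; exists (b * a); now rewrite conjM. Qed.

Section SummitSets.
Hypothesis Delta_neq1 : Delta <> 1.
Variable X : G.
Hypothesis SSS_X : in_SSS X X.

Lemma in_SSS_pre Y : in_SSS X Y <->
  conjugate Y X /\ D^ (ginf X) <<= Y /\ Y <<= D^ (gsup X).
Proof.
  rewrite pre_ginf, gsup_pre by easy; destruct SSS_X as [_ MX]; split.
  - intros [CY MY]; split; [easy|]; apply MY, conjugate_refl.
  - intros [CY [HiY HsY]]; split; [easy|]; intros Z CZ.
    destruct (MX Z CZ); lia.
Qed.

(** Along the orbit the infimum cannot drop, by [pre_cyc], nor exceed that of [X]; cycling thus
    always uses the fixed exponent [ginf X]. *)
Lemma iter_cycling Y n : in_SSS X Y ->
  Nat.iter n (@cycling G) Y = Nat.iter n (cyc (ginf X)) Y.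
Proof.
  intros SY.
  assert (H : Nat.iter n (@cycling G) Y = Nat.iter n (cyc (ginf X)) Y /\
              conjugate (Nat.iter n (cyc (ginf X)) Y) X /\
              D^ (ginf X) <<= Nat.iter n (cyc (ginf X)) Y); [|easy].
  induction n as [|n [E [C H]]]; simpl.
  - apply in_SSS_pre in SY; now split.
  - split; [|split; [now apply conjugate_conj|now apply pre_cyc]].
    rewrite E; unfold cycling; rewrite giotaE by easy.
    set (Z := Nat.iter _ (cyc _) _) in *; unfold cyc at 1.
    replace (ginf Z) with (ginf X); [easy|].
    apply pre_ginf in H; [|easy]; destruct SSS_X as [_ MX].
    destruct (MX Z C); lia.
Qed.

Lemma in_USS_cyc Y :
  in_USS X Y <-> in_SSS X Y /\ periodic (cyc (ginf X)) Y.
Proof.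
  split; intros [SY [n [n0 E]]]; split; try easy; exists n; split; try easy;
    generalize (iter_cycling n SY); congruence.
Qed.

(** Without inverses, the two bounds compare [s * D^ k] with [X * s]; both expressions preserve
    meets in [s]. *)
Lemma in_SSS_meet s t : in_SSS X (conj X s) -> in_SSS X (conj X t) ->
  in_SSS X (conj X (s ^^ t)).
Proof.
  rewrite !in_SSS_pre, !pre_conj_pow, !pre_pow_conj.
  intros [_ [is ss]] [_ [it st]]; split.
  - apply conjugate_conj, conjugate_refl.
  - rewrite !meet_mulD, !mul_meet, !pre_meet; repeat split.
    + apply pre_trans with (s * D^ (ginf X)); [apply meet_prel|easy].
    + apply pre_trans with (t * D^ (ginf X)); [apply meet_prer|easy].
    + apply pre_trans with (X * s); [apply meet_prel|easy].
    + apply pre_trans with (X * t); [apply meet_prer|easy].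
Qed.

Lemma in_SSS_iotV : in_SSS X (conj X (iot (- gsup X) X^-1)).
Proof.
  assert (H := proj1 (in_SSS_pre X) SSS_X); destruct H as [CX [iX sX]].
  apply in_SSS_pre; split; [now apply conjugate_conj|].
  rewrite pre_conj_pow, pre_pow_conj; unfold iot; rewrite Z.opp_involutive.
  split.
  - rewrite mul_meet, mulKr, pre_meet; split.
    (* Either [X] is a power of [Delta] and the conjugator is [1], or the gap between infimum and
       supremum absorbs one factor [Delta]. *)
    + destruct (Z_le_gt_dec (gsup X) (ginf X)) as [H|H].
      * assert (E : X = D^ (gsup X)).
        { apply pre_antisym; [easy|].
          apply pre_trans with D^ (ginf X); [now apply pre_pow|easy]. }
        rewrite <- E, gmulVl, meet_l by apply pos_Delta.
        now rewrite gmul1l.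
      * apply pre_trans with (Delta * D^ (ginf X)).
        -- apply pre_mul2r, meet_prer.
        -- rewrite <- gpow_succ; apply pre_pow; lia.
    + apply pre_trans with (Delta * D^ (ginf X)).
      * apply pre_mul2r, meet_prer.
      * rewrite <- gpow_comm; now apply pre_mul2D.
  (* The last comparison holds because the conjugator is positive, as [X <<= D^ (gsup X)]. *)
  - apply pre_trans with D^ (gsup X); [rewrite mul_meet, mulKr; apply meet_prel|].
    rewrite <- (gmul1l D^ (gsup X)) at 1; apply pre_mul2r, pre_meet.
    split; [|apply pos_Delta].
    now rewrite <- (pre_mul2l X), mulKr, gmul1r.
Qed.

End SummitSets.

End GarsideTheory.

Theorem theorem2 (G : GarsideGroup) (X s : G) :
  in_USS X X ->
  minimal_simple X X s ->
  xor (simple (gmul (gvarphi X) s)) (left_weighted (gvarphi X) s).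
Proof.
  intros UX [[Ps sD] [s1 [Us Ms]]].
  (* With [Delta] trivial, the only simple element would be [1], but [s] is not. *)
  assert (D1 : gDelta G <> gone G).
  { intros E; apply s1, pre_antisym; [now rewrite <- E|easy]. }
  destruct (gpartial_gvarphi X D1) as [Sphi Ephi].
  assert (W : forall t, prefix t (gpartial (gvarphi X)) <->
                        prefix (gmul (gvarphi X) t) (gDelta G)).
  { intros t; unfold gpartial.
    now rewrite <- (pre_mul2l (gvarphi X)), mulKr. }
  set (t := gmeet (gpartial (gvarphi X)) s).
  assert (Ut : in_USS X (conj X t)).
  { assert (SX : in_SSS X X) by apply UX.
    apply in_USS_cyc in UX, Us; try easy; apply in_USS_cyc; try easy.
    destruct UX as [_ PX], Us as [Ss Pss]; unfold t; rewrite Ephi; split.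
    - apply in_SSS_meet; [easy|easy|now apply in_SSS_iotV|easy].
    - apply periodic_cyc_meet; try easy; [|now apply periodic_cyc_iotV].
      split; [|apply meet_prer].
      rewrite <- Ephi; apply W; rewrite gmul1r; apply Sphi. }
  (* Minimality of [s] applies to its prefix [t], which conjugates [X] into the ultra summit set. *)
  assert (Et : t = gone G \/ t = s).
  { destruct (classic (t = gone G)) as [|t1]; [now left|right].
    apply NNPP; intros ts; apply (Ms t); try easy; [|apply meet_prer].
    apply pre_meet; split; [|easy]; apply W; rewrite gmul1r; apply Sphi. }
  assert (Hs : simple (gmul (gvarphi X) s) <-> t = s).
  { split.
    - intros [_ H]; unfold t; rewrite meetC; now apply meet_l, W.
    - intros E; split.
      + apply pre_trans with (gvarphi X); [apply Sphi|now apply pre_mulr].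
      + apply W; rewrite <- E; apply meet_prel. }
  assert (Hw : left_weighted (gvarphi X) s <-> t = gone G).
  { split; [now intros [_ [_ E]]|intros E; split; [easy|split; [now split|easy]]]. }
  (* The cases [t = s] and [t = 1] exclude each other because [s] is nontrivial. *)
  unfold xor; rewrite Hs, Hw.
  destruct Et as [E|E]; [right|left]; (split; [congruence|]); congruence.
Qed.
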